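(* Let $I$ be a non-empty set, let $E$ be a Banach sequence lattice on $I$, let $(A_i)_{i\in I}$ be a family of Banach algebras and let $A=\bigl(\bigoplus_{i\in I}A_i\bigr)_E$ be their $E$-sum. If $A$ is weakly amenable, then each $A_i$ is weakly amenable. More quantitatively, if $\mathrm{WAM}(A)<\infty$, then for each $i\in I$, $$\mathrm{WAM}(A_i)\le\|\iota_i\|\,\mathrm{WAM}(A)=\|\delta_i\|_E\,\mathrm{WAM}(A),$$ where $\iota_i\colon A_i\to A$ is the coordinate embedding.
   Context: $c_{00}(I)$ denotes the space of finitely supported complex-valued functions on $I$; $\delta_i$ is the Dirac mass at $i$, i.e. the characteristic function of $\{i\}$. Weak amenability. For a Banach algebra $A$, the dual $A^*$ is an $A$-bimodule via $(a\cdot\phi)(x)=\phi(xa)$, $(\phi\cdot a)(x)=\phi(ax)$ for $a,x\in A$, $\phi\in A^*$. A bounded linear map $D\colon A\to A^*$ is a derivation if $D(ab)=a\cdot D(b)+D(a)\cdot b$ for all $a,b\in A$. For $\phi\in A^*$, $\mathrm{ad}_\phi(a):=a\cdot\phi-\phi\cdot a$ is the inner derivation implemented by $\phi$. $A$ is weakly amenable if every bounded derivation $D\colon A\to A^*$ is inner. The weak amenability constant $\mathrm{WAM}(A)\in[0,\infty]$ is the infimum of all $C\ge0$ such that for every bounded derivation $D\colon A\to A^*$ there is $\phi\in A^*$ with $D=\mathrm{ad}_\phi$ and $\|\phi\|\le C\|D\|$; $\mathrm{WAM}(A)=+\infty$ if $A$ is not weakly amenable. Banach sequence lattice. A Banach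 sequence lattice on $I$ is a Banach space $E$ of complex-valued functions on $I$ such that (a) $c_{00}(I)\subseteq E\subseteq\ell_\infty(I)$ and $c_{00}(I)$ is dense in $E$; (b) $E$ is solid: if $y\in E$ and $x\in\ell_\infty(I)$ satisfy $|x_i|\le|y_i|$ for all $i\in I$, then $x\in E$ and $\|x\|_E\le\|y\|_E$; (c) $\|x\|_\infty\le\|x\|_E$ for all $x\in E$. $E$-sum. $\bigl(\bigoplus_{i\in I}A_i\bigr)_E$ is the Banach algebra of all families $a=(a_i)_{i\in I}$ with $a_i\in A_i$ and $(\|a_i\|)_{i\in I}\in E$, with norm $\|a\|=\|(\|a_i\|)_{i\in I}\|_E$ and coordinatewise multiplication. The coordinate embedding $\iota_i\colon A_i\to A$ sends $b$ to the family with $i$th coordinate $b$ and all other coordinates $0$.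
   Formalization: The equality ‖ι_i‖WAM(A)=‖δ_i‖_E WAM(A) is stated only for nonzero A_i, since it can fail when A_i=0 (then ‖ι_i‖=0); the bounds of WAM(A_i) by both quantities are stated for all A_i. *)

(* Defs.v *)
From HB Require Import structures.
From mathcomp Require Import all_boot all_order all_algebra.
From mathcomp Require Import all_classical all_reals.
From mathcomp Require Import ereal topology normedtype.
From mathcomp Require Export complex.

Set Implicit Arguments.
Unset Strict Implicit.
Unset Printing Implicit Defensive.

Import Order.TTheory GRing.Theory Num.Theory.
Import numFieldNormedType.Exports.
Local Open Scope classical_set_scope.
Local Open Scope complex_scope.
Local Open Scope ring_scope.

(* In a normed space over [R[i]] the library norm [`|x|] takes its values in
   [R[i]] (it is a nonnegative real there); [rnorm x] is the same number, as an
   element of [R]. *)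
Definition rnorm (R : realType) (V : normedZmodType R[i]) (x : V) : R :=
  complex.Re `|x|.

Definition bounded_map (R : realType) (V W : normedZmodType R[i])
    (f : V -> W) : Prop :=
  exists M : R, forall x, rnorm (f x) <= M * rnorm x.

(* Only meaningful for maps satisfying [bounded_map]. *)
Definition opnorm (R : realType) (V W : normedZmodType R[i])
    (f : V -> W) : R :=
  inf [set M : R | 0 <= M /\ forall x, rnorm (f x) <= M * rnorm x].

Section rnorm_theory.
Variables (R : realType).

Lemma normE (V : normedZmodType R[i]) (x : V) : `|x| = (rnorm x)%:C.
Proof. by rewrite /rnorm RRe_real ?normr_real. Qed.

Lemma rnorm_ge0 (V : normedZmodType R[i]) (x : V) : 0 <= rnorm x.
Proof. by rewrite -lecR -normE; exact: normr_ge0. Qed.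

Lemma rnormD (V : normedZmodType R[i]) (x y : V) :
  rnorm (x + y) <= rnorm x + rnorm y.
Proof. by rewrite -lecR rmorphD/= -!normE ler_normD. Qed.

Lemma rnorm0 (V : normedZmodType R[i]) : rnorm (0 : V) = 0.
Proof. by rewrite /rnorm normr0. Qed.

Lemma rnormN (V : normedZmodType R[i]) (x : V) : rnorm (- x) = rnorm x.
Proof. by rewrite /rnorm normrN. Qed.

Lemma rnormM (x y : R[i]) : rnorm (x * y) = rnorm x * rnorm y.
Proof. by apply: complexI; rewrite rmorphM/= -!normE normrM. Qed.

Lemma rnormZ (V : normedModType R[i]) (c : R[i]) (x : V) :
  rnorm (c *: x) = rnorm c * rnorm x.
Proof. by apply: complexI; rewrite rmorphM/= -!normE normrZ. Qed.

Lemma rnorm_eq0 (V : normedZmodType R[i]) (x : V) : rnorm x = 0 -> x = 0.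
Proof. by move=> x0; apply: normr0_eq0; rewrite normE x0. Qed.

Lemma opnorm_ge0 (V W : normedZmodType R[i]) (f : V -> W) : 0 <= opnorm f.
Proof.
rewrite /opnorm; set S := [set M | _].
have [->|S0] := eqVneq S set0; first by rewrite inf0.
by apply: lb_le_inf; [exact/set0P|move=> M []].
Qed.

Lemma opnorm_le (V W : normedZmodType R[i]) (f : V -> W) (M : R) :
  0 <= M -> (forall x, rnorm (f x) <= M * rnorm x) -> opnorm f <= M.
Proof. by move=> M0 fM; apply: ge_inf; [exists 0 => N []|split]. Qed.

Lemma opnormP (V W : normedZmodType R[i]) (f : V -> W) :
  bounded_map f -> forall x, rnorm (f x) <= opnorm f * rnorm x.
Proof.
move=> [M fM] x.
have [x0|x0] := eqVneq (rnorm x) 0.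
  by have := fM x; rewrite x0 !mulr0.
have xp : 0 < rnorm x by rewrite lt_neqAle eq_sym x0 rnorm_ge0.
rewrite -ler_pdivrMr//; apply: lb_le_inf.
  exists `|M|; split=> // y; apply: le_trans (fM y) _.
  by rewrite ler_wpM2r ?rnorm_ge0 ?ler_norm.
by move=> N [N0 fN]; rewrite ler_pdivrMr.
Qed.

Lemma rnorm_norm (V : normedZmodType R[i]) (x : V) :
  rnorm (`|x| : R[i]) = rnorm x.
Proof. by rewrite /rnorm normr_id. Qed.

Lemma rnormDnorm (V : normedZmodType R[i]) (x y : V) :
  rnorm (x + y) <= rnorm (`|x| + `|y| : R[i]).
Proof.
by rewrite -lecR -!normE (le_trans (ler_normD _ _))// ger0_norm// addr_ge0.
Qed.

Lemma contraction_cauchy (V W : normedModType R[i]) (f : V -> W)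
    (F : set_system V) : ProperFilter F ->
  (forall x y, `|f x - f y| <= `|x - y|) -> cauchy F -> cauchy (f @ F).
Proof.
move=> FF fc /cauchyP Fc; apply/cauchy_exP => e e0.
have [x Fx] := Fc e e0; exists (f x).
change (F (f @^-1` ball (f x) e)); apply: (filterS _ Fx) => y.
by rewrite /preimage/= -!ball_normE /=; exact: le_lt_trans.
Qed.

End rnorm_theory.

Section dual.
Variables (R : realType) (V : normedModType R[i]).

Definition dual_pred : {pred V -> R[i]} :=
  fun f => `[< scalar f /\ bounded_map f >].

Record dual := Dual { dual_fun :> V -> R[i]; _ : dual_fun \in dual_pred }.

HB.instance Definition _ := [isSub for dual_fun].
HB.instance Definition _ := [Choice of dual by <:].

Lemma dual_predP (f : V -> R[i]) :
  reflect (scalar f /\ bounded_map f) (f \in dual_pred).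
Proof. exact: asboolP. Qed.

Lemma dual_submod_closed : submod_closed dual_pred.
Proof.
split=> [|c f g /dual_predP[fl [M fM]] /dual_predP[gl [N gN]]]; apply/dual_predP.
  split=> [k x y|]; first by rewrite /= /GRing.zero /= mulr0 addr0.
  by exists 0 => x; rewrite mul0r /GRing.zero/= rnorm0.
have E x : (c *: f + g) x = c * f x + g x by [].
split=> [k x y|]; first by rewrite !E fl gl !mulrDr mulrCA -!addrA; congr +%R;
  rewrite addrCA.
exists (rnorm c * M + N) => x; rewrite E (le_trans (rnormD _ _))//.
by rewrite mulrDl lerD// rnormM -mulrA ler_wpM2l ?rnorm_ge0.
Qed.

HB.instance Definition _ :=
  GRing.isSubmodClosed.Build R[i] (V -> R[i]) dual_pred dual_submod_closed.
HB.instance Definition _ := [SubChoice_isSubLmodule of dual by <:].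

Lemma dual_linear (f : dual) : scalar f.
Proof. by case: f => f /= /dual_predP[]. Qed.

Lemma dual_bounded (f : dual) : bounded_map f.
Proof. by case: f => f /= /dual_predP[]. Qed.

HB.instance Definition _ (f : dual) :=
  GRing.isLinear.Build R[i] V R[i] *%R f (dual_linear f).

Definition dual_norm (f : dual) : R[i] := (opnorm f)%:C.

Lemma dual_normD f g : dual_norm (f + g) <= dual_norm f + dual_norm g.
Proof.
rewrite -rmorphD lecR; apply: opnorm_le; first by rewrite addr_ge0 ?opnorm_ge0.
move=> x; rewrite mulrDl (le_trans (rnormD (f x) (g x)))//.
by rewrite lerD// opnormP//; exact: dual_bounded.
Qed.

Lemma dual_normZ (c : R[i]) f : dual_norm (c *: f) = `|c| * dual_norm f.
Proof.
rewrite /dual_norm normE -rmorphM; congr (_ %:C).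
have le k g : opnorm (k *: g : dual) <= rnorm k * opnorm g.
  apply: opnorm_le; first by rewrite mulr_ge0 ?opnorm_ge0 ?rnorm_ge0.
  move=> x; rewrite -mulrA (_ : (k *: g) x = k * g x)// rnormM.
  by rewrite ler_wpM2l ?rnorm_ge0 ?opnormP//; exact: dual_bounded.
apply/eqP; rewrite eq_le le/=.
have [->|c0] := eqVneq c 0; first by rewrite rnorm0 mul0r opnorm_ge0.
have rc : 0 < rnorm c.
  by rewrite lt_neqAle rnorm_ge0 andbT eq_sym; apply: contra_neq c0 => /rnorm_eq0.
have := le c^-1 (c *: f); rewrite scalerA mulVf// scale1r.
rewrite (_ : rnorm c^-1 = (rnorm c)^-1); first by rewrite ler_pdivlMl.
apply: (mulfI (lt0r_neq0 rc)); rewrite -rnormM !mulfV ?(lt0r_neq0 rc)//.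
by rewrite /rnorm normr1.
Qed.

Lemma dual_norm_eq0 f : dual_norm f = 0 -> f = 0.
Proof.
move=> /complexI f0; apply: val_inj; apply/funext => x /=.
apply: rnorm_eq0; apply/eqP; rewrite eq_le rnorm_ge0 andbT.
by rewrite (le_trans (opnormP (dual_bounded f) x))// f0 mul0r.
Qed.

HB.instance Definition _ := Lmodule_isNormed.Build R[i] dual
  dual_normD dual_normZ dual_norm_eq0.

End dual.

(* Banach algebras are not assumed to be unital, so the ring structures of the
   library do not apply. *)

HB.mixin Record CompleteNormedModule_isBanachAlgebra (K : numFieldType) A
    & CompleteNormedModule K A := {
  bmul : A -> A -> A ;
  bmulA : associative bmul ;
  bmul_linearl : forall b, linear (bmul^~ b) ;
  bmul_linearr : forall a, linear (bmul a) ;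
  bmul_norm : forall a b, `|bmul a b| <= `|a| * `|b|
}.

#[short(type="banachAlgType")]
HB.structure Definition BanachAlgebra (K : numFieldType) :=
  {A of CompleteNormedModule K A & CompleteNormedModule_isBanachAlgebra K A}.

Section weak_amenability.
Variables (R : realType) (A : banachAlgType R[i]).
Implicit Types (a b x : A) (phi : dual A) (D : {linear A -> dual A}).

Lemma rnorm_bmul a b : rnorm (bmul a b) <= rnorm a * rnorm b.
Proof. by rewrite -lecR rmorphM/= -!normE bmul_norm. Qed.

Lemma dual_lact_subproof a phi : (fun x => phi (bmul x a)) \in @dual_pred R A.
Proof.
apply/dual_predP; split=> [k x y|].
  by rewrite bmul_linearl dual_linear.
exists (opnorm phi * rnorm a) => x.
rewrite (le_trans (opnormP (dual_bounded phi) _))//.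
by rewrite -mulrA ler_wpM2l ?opnorm_ge0// mulrC rnorm_bmul.
Qed.

Definition dual_lact a phi : dual A := Dual (dual_lact_subproof a phi).

Lemma dual_ract_subproof phi a : (fun x => phi (bmul a x)) \in @dual_pred R A.
Proof.
apply/dual_predP; split=> [k x y|].
  by rewrite bmul_linearr dual_linear.
exists (opnorm phi * rnorm a) => x.
rewrite (le_trans (opnormP (dual_bounded phi) _))//.
by rewrite -mulrA ler_wpM2l ?opnorm_ge0// rnorm_bmul.
Qed.

Definition dual_ract phi a : dual A := Dual (dual_ract_subproof phi a).

Definition derivation D : Prop :=
  forall a b, D (bmul a b) = dual_lact a (D b) + dual_ract (D a) b.

Definition bounded_derivation D : Prop := bounded_map D /\ derivation D.

Definition ad phi a : dual A := dual_lact a phi - dual_ract phi a.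

Definition weakly_amenable : Prop :=
  forall D, bounded_derivation D -> exists phi, D =1 ad phi.

(* The infimum of the empty set is [+oo], so [WAM = +oo] whenever the algebra is
   not weakly amenable. *)
Definition WAM : \bar R :=
  ereal_inf [set C%:E | C in [set C : R | 0 <= C /\
    forall D, bounded_derivation D ->
      exists2 phi, D =1 ad phi & rnorm phi <= C * opnorm D]].

End weak_amenability.

(* A Banach space [E] of functions [I -> R[i]] is a complete normed module with
   an injective linear map [bsl_fun] sending each element to the function it
   is. *)
Record bseqLattice (R : realType) (I : choiceType) := BSeqLattice {
  bsl_space :> completeNormedModType R[i] ;
  bsl_fun : bsl_space -> I -> R[i] ;
  bsl_fun_linear : linear bsl_fun ;
  bsl_fun_inj : injective bsl_fun ;
  bsl_c00 : forall f : I -> R[i], finite_set [set i | f i != 0] ->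
    exists x, bsl_fun x = f ;
  bsl_linfty : forall x, exists M : R, forall i, rnorm (bsl_fun x i) <= M ;
  bsl_dense : dense [set x | finite_set [set i | bsl_fun x i != 0]] ;
  bsl_solid : forall (y : bsl_space) (f : I -> R[i]),
    (exists M : R, forall i, rnorm (f i) <= M) ->
    (forall i, rnorm (f i) <= rnorm (bsl_fun y i)) ->
    exists2 x, bsl_fun x = f & rnorm x <= rnorm y ;
  bsl_sup : forall x i, rnorm (bsl_fun x i) <= rnorm x
}.

(* [bsl_norm E f] is the norm of the function [f] in [E]; it is meaningful only
   when [f] belongs to [E], and [0] by convention otherwise. *)
Definition bsl_mem (R : realType) (I : choiceType) (E : bseqLattice R I)
    (f : I -> R[i]) : Prop := exists x : E, bsl_fun x = f.

Definition bsl_elt (R : realType) (I : choiceType) (E : bseqLattice R I)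
    (f : I -> R[i]) : E :=
  if pselect (bsl_mem E f) is left h then sval (cid h) else 0.

Definition bsl_norm (R : realType) (I : choiceType) (E : bseqLattice R I)
    (f : I -> R[i]) : R := rnorm (bsl_elt E f).

Definition dirac_fun (R : realType) (I : choiceType) (i : I) : I -> R[i] :=
  fun j => (j == i)%:R.

Section bseqLattice_theory.
Variables (R : realType) (I : choiceType) (E : bseqLattice R I).
Implicit Types (x y : E) (f g : I -> R[i]).

Lemma bsl_eltK f : bsl_mem E f -> bsl_fun (bsl_elt E f) = f.
Proof. by rewrite /bsl_elt; case: pselect => // h _; case: cid. Qed.

Lemma bsl_funK x : bsl_elt E (bsl_fun x) = x.
Proof. by apply: bsl_fun_inj; rewrite bsl_eltK//; exists x. Qed.

Lemma bsl_funD x y i : bsl_fun (x + y) i = bsl_fun x i + bsl_fun y i.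
Proof. by rewrite -[x in LHS]scale1r bsl_fun_linear scale1r. Qed.

Lemma bsl_fun0 i : bsl_fun (0 : E) i = 0.
Proof. by apply: (@addIr _ (bsl_fun (0 : E) i)); rewrite -bsl_funD !add0r. Qed.

Lemma bsl_funZ c x i : bsl_fun (c *: x) i = c * bsl_fun x i.
Proof.
by rewrite -[c *: x]addr0 bsl_fun_linear -[RHS]addr0 -(bsl_fun0 i).
Qed.

Lemma bsl_funB x y i : bsl_fun (x - y) i = bsl_fun x i - bsl_fun y i.
Proof. by rewrite bsl_funD -scaleN1r bsl_funZ mulN1r. Qed.

Lemma bsl_mem_le f y :
  (forall i, rnorm (f i) <= rnorm (bsl_fun y i)) -> bsl_mem E f.
Proof.
move=> fy; have [M yM] := bsl_linfty y.
have [|x <- _] := @bsl_solid _ _ E y f _ fy; last by exists x.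
by exists M => i; exact: le_trans (fy i) (yM i).
Qed.

Lemma bsl_le x y :
  (forall i, rnorm (bsl_fun x i) <= rnorm (bsl_fun y i)) -> `|x| <= `|y|.
Proof.
move=> xy; have [z /bsl_fun_inj <-] := @bsl_solid _ _ E y _ (bsl_linfty x) xy.
by rewrite !normE lecR.
Qed.

End bseqLattice_theory.

(* [bslsum E A] is the [E]-sum of the family [A], [bslsum_inj E A i] its i-th
   coordinate embedding. *)
Section bslsum.
Variables (R : realType) (I : choiceType) (E : bseqLattice R I).
Variable A : I -> banachAlgType R[i].

Definition bslsum_pred (a : forall i, A i) : Prop :=
  bsl_mem E (fun i => `|a i|).

Record bslsum := BslSum { bslsum_fun :> forall i, A i ; bslsumP : bslsum_pred bslsum_fun }.

HB.instance Definition _ := gen_eqMixin bslsum.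
HB.instance Definition _ := gen_choiceMixin bslsum.

Implicit Types a b c : bslsum.

Lemma bslsum_eq a b : (forall i, a i = b i) -> a = b.
Proof.
case: a b => [a aP] [b bP] /= ab.
have {}ab : a = b by apply/functional_extensionality_dep.
by rewrite {a}ab in aP *; congr BslSum; exact: Prop_irrelevance.
Qed.

Definition bslsum_nrm a : E := bsl_elt E (fun i => `|a i|).

Lemma bslsum_nrmE a i : bsl_fun (bslsum_nrm a) i = `|a i|.
Proof. by rewrite bsl_eltK//; exact: bslsumP. Qed.

Lemma bslsum_pred_le (a : forall i, A i) (y : E) :
  (forall i, rnorm (a i) <= rnorm (bsl_fun y i)) -> bslsum_pred a.
Proof. by move=> ay; apply: (@bsl_mem_le _ _ E _ y) => i; rewrite rnorm_norm. Qed.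

Lemma bslsum0_subproof : bslsum_pred (fun i => 0 : A i).
Proof. by apply: (@bslsum_pred_le _ 0) => i; rewrite rnorm0 rnorm_ge0. Qed.

Lemma bslsumD_subproof a b : bslsum_pred (fun i => a i + b i).
Proof.
apply: (@bslsum_pred_le _ (bslsum_nrm a + bslsum_nrm b)) => i.
by rewrite bsl_funD !bslsum_nrmE rnormDnorm.
Qed.

Lemma bslsumN_subproof a : bslsum_pred (fun i => - a i).
Proof.
by apply: (@bslsum_pred_le _ (bslsum_nrm a)) => i; rewrite rnormN bslsum_nrmE rnorm_norm.
Qed.

Lemma bslsumZ_subproof (c : R[i]) a : bslsum_pred (fun i => c *: a i).
Proof.
apply: (@bslsum_pred_le _ (c *: bslsum_nrm a)) => i.
by rewrite bsl_funZ bslsum_nrmE rnormM rnormZ rnorm_norm.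
Qed.

Lemma bslsum_coord_le a i : rnorm (a i) <= rnorm (bslsum_nrm a).
Proof. by have := bsl_sup (bslsum_nrm a) i; rewrite bslsum_nrmE rnorm_norm. Qed.

Lemma bslsumM_subproof a b : bslsum_pred (fun i => bmul (a i) (b i)).
Proof.
apply: (@bslsum_pred_le _ (`|bslsum_nrm a| *: bslsum_nrm b)) => i.
rewrite bsl_funZ bslsum_nrmE rnormM !rnorm_norm (le_trans (rnorm_bmul _ _))//.
by rewrite ler_wpM2r ?rnorm_ge0 ?bslsum_coord_le.
Qed.

Definition bslsum0 := BslSum bslsum0_subproof.
Definition bslsumD a b := BslSum (bslsumD_subproof a b).
Definition bslsumN a := BslSum (bslsumN_subproof a).
Definition bslsumZ (c : R[i]) a := BslSum (bslsumZ_subproof c a).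
Definition bslsumM a b := BslSum (bslsumM_subproof a b).

Lemma bslsumDA : associative bslsumD.
Proof. by move=> a b c; apply: bslsum_eq => i; exact: addrA. Qed.
Lemma bslsumDC : commutative bslsumD.
Proof. by move=> a b; apply: bslsum_eq => i; exact: addrC. Qed.
Lemma bslsum0D : left_id bslsum0 bslsumD.
Proof. by move=> a; apply: bslsum_eq => i; exact: add0r. Qed.
Lemma bslsumND : left_inverse bslsum0 bslsumN bslsumD.
Proof. by move=> a; apply: bslsum_eq => i; exact: addNr. Qed.

HB.instance Definition _ :=
  GRing.isZmodule.Build bslsum bslsumDA bslsumDC bslsum0D bslsumND.

Lemma bslsumZA (c d : R[i]) a : bslsumZ c (bslsumZ d a) = bslsumZ (c * d) a.
Proof. by apply: bslsum_eq => i; exact: scalerA. Qed.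
Lemma bslsum1Z : left_id 1 bslsumZ.
Proof. by move=> a; apply: bslsum_eq => i; exact: scale1r. Qed.
Lemma bslsumZDr : right_distributive bslsumZ +%R.
Proof. by move=> c a b; apply: bslsum_eq => i; exact: scalerDr. Qed.
Lemma bslsumZDl a : {morph bslsumZ^~ a : c d / c + d}.
Proof. by move=> c d; apply: bslsum_eq => i; exact: scalerDl. Qed.

HB.instance Definition _ := GRing.Zmodule_isLmodule.Build R[i] bslsum
  bslsumZA bslsum1Z bslsumZDr bslsumZDl.

Definition bslsum_norm a : R[i] := (bsl_norm E (fun i => `|a i|))%:C.

Lemma bslsum_normE a : bslsum_norm a = `|bslsum_nrm a|.
Proof. by rewrite normE. Qed.

Lemma bslsum_normD a b : bslsum_norm (a + b) <= bslsum_norm a + bslsum_norm b.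
Proof.
rewrite !bslsum_normE (le_trans _ (ler_normD _ _))//; apply: bsl_le => i.
by rewrite bsl_funD !bslsum_nrmE rnorm_norm rnormDnorm.
Qed.

Lemma bslsum_normZ (c : R[i]) a : bslsum_norm (c *: a) = `|c| * bslsum_norm a.
Proof.
rewrite !bslsum_normE -[`|c|]normr_id -normrZ; congr (`|_|); apply: bsl_fun_inj.
by apply/funext => i; rewrite bsl_funZ !bslsum_nrmE normrZ.
Qed.

Lemma bslsum_norm_eq0 a : bslsum_norm a = 0 -> a = 0.
Proof.
rewrite bslsum_normE => /normr0_eq0 a0; apply: bslsum_eq => i.
by apply: normr0_eq0; rewrite -bslsum_nrmE a0 bsl_fun0.
Qed.

HB.instance Definition _ := Lmodule_isNormed.Build R[i] bslsum
  bslsum_normD bslsum_normZ bslsum_norm_eq0.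

Lemma bslsum_normrE a : `|a| = `|bslsum_nrm a|.
Proof. by rewrite -bslsum_normE. Qed.

Lemma bslsum_normr_le a (y : E) :
  (forall i, rnorm (a i) <= rnorm (bsl_fun y i)) -> `|a| <= `|y|.
Proof.
by move=> ay; rewrite bslsum_normrE; apply: bsl_le => i; rewrite bslsum_nrmE rnorm_norm.
Qed.

Lemma bslsum_coord_normr a i : `|a i| <= `|a|.
Proof. by rewrite bslsum_normrE !normE lecR bslsum_coord_le. Qed.

Lemma contraction_bslsum_coord i a b : `|a i - b i| <= `|a - b|.
Proof. exact: (bslsum_coord_normr (a - b)). Qed.

Lemma contraction_bslsum_nrm c a b :
  `|bslsum_nrm (a - c) - bslsum_nrm (b - c)| <= `|a - b|.
Proof.
rewrite [leRHS]bslsum_normrE; apply: bsl_le => i; rewrite bsl_funB !bslsum_nrmE.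
rewrite rnorm_norm -lecR -!normE (le_trans (ler_dist_dist _ _))//.
change (`|(a i - c i) - (b i - c i)| <= `|(a - b) i|).
by rewrite opprB subrKA.
Qed.

Lemma bslsum_cauchy_cvg (F : set_system bslsum) :
  ProperFilter F -> cauchy F -> cvg F.
Proof.
move=> FF Fc.
have Fex i : exists l : A i, (fun a : bslsum => a i) @ F --> l.
  by apply/cvg_ex; apply: cauchy_cvg; apply: contraction_cauchy Fc => a b;
    exact: contraction_bslsum_coord.
pose l i := sval (cid (Fex i)).
have Fl i : (fun a : bslsum => a i) @ F --> l i by rewrite /l; case: cid.
have Fn c : exists2 y : E, (fun a => bslsum_nrm (a - c)) @ F --> y &
    forall i, bsl_fun y i = `|l i - c i|.
  have /cvg_ex[y Fy] : cvg ((fun a => bslsum_nrm (a - c)) @ F).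
    by apply: cauchy_cvg; apply: contraction_cauchy Fc => a b; exact: contraction_bslsum_nrm.
  exists y => // i; apply/eqP; rewrite -subr_eq0 -normr_le0.
  apply/ler_addgt0Pl => e e0; rewrite addr0.
  have e20 : 0 < e / 2 by rewrite divr_gt0.
  move/cvgrPdist_lt: (Fy) => /(_ _ e20) H1.
  move/cvgrPdist_lt: (Fl i) => /(_ _ e20) H2.
  have [a [a1 a2]] := filter_ex (filterI H1 H2).
  rewrite [e]splitr -(subrKA `|a i - c i|) (le_trans (ler_normD _ _))// lerD//.
    rewrite -[`|a i - c i|](bslsum_nrmE (a - c)) -bsl_funB.
    by apply: le_trans (ltW a1); rewrite !normE lecR bsl_sup.
  apply: (le_trans (ler_dist_dist _ _)).
  by rewrite opprB subrKA distrC ltW.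
have lP : bslsum_pred l.
  have [y _ yl] := Fn 0; apply: (@bslsum_pred_le _ y) => i.
  by rewrite yl subr0 rnorm_norm.
apply/cvg_ex; exists (BslSum lP); apply/cvgrPdist_le => e e0.
have e20 : 0 < e / 2 by rewrite divr_gt0.
have [c Fe] := (cauchyP F).1 Fc _ e20.
have lc : `|BslSum lP - c| <= e / 2.
  have [y Fy yl] := Fn c.
  have -> : `|BslSum lP - c| = `|y|.
    rewrite bslsum_normrE; congr (`|_|); apply: bsl_fun_inj; apply/funext => i.
    by rewrite bslsum_nrmE yl.
  apply/ler_addgt0Pl => d d0; move/cvgrPdist_lt: (Fy) => /(_ _ d0) H1.
  have [a [a1 a2]] := filter_ex (filterI H1 Fe).
  rewrite -(subrK (bslsum_nrm (a - c)) y) (le_trans (ler_normD _ _))// lerD//.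
    exact: ltW.
  by move: a2; rewrite -ball_normE -bslsum_normrE distrC => /ltW.
near=> a.
rewrite [e]splitr -(subrKA c) (le_trans (ler_normD _ _))// lerD//.
have: ball c (e / 2) a by near: a.
by rewrite -ball_normE => /ltW.
Unshelve. all: by end_near. Qed.

HB.instance Definition _ := Uniform_isComplete.Build bslsum bslsum_cauchy_cvg.

Lemma bslsumMA : associative bslsumM.
Proof. by move=> a b c; apply: bslsum_eq => i; exact: bmulA. Qed.
Lemma bslsumM_linearl b : linear (bslsumM^~ b).
Proof. by move=> k a c; apply: bslsum_eq => i; exact: bmul_linearl. Qed.
Lemma bslsumM_linearr a : linear (bslsumM a).
Proof. by move=> k b c; apply: bslsum_eq => i; exact: bmul_linearr. Qed.
Lemma bslsumM_norm a b : `|bslsumM a b| <= `|a| * `|b|.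
Proof.
rewrite [`|a|]bslsum_normrE [`|b|]bslsum_normrE -[`|bslsum_nrm a|]normr_id -normrZ.
apply: bslsum_normr_le => i; rewrite bsl_funZ bslsum_nrmE rnormM !rnorm_norm.
by rewrite (le_trans (rnorm_bmul _ _))// ler_wpM2r ?rnorm_ge0 ?bslsum_coord_le.
Qed.

HB.instance Definition _ :=
  CompleteNormedModule_isBanachAlgebra.Build R[i] bslsum
    bslsumMA bslsumM_linearl bslsumM_linearr bslsumM_norm.

Lemma bslsum_inj_subproof (i : I) (b : A i) :
  bslsum_pred (dfwith (fun j => 0 : A j) i b).
Proof.
apply: bsl_c00; apply: (@sub_finite_set _ _ [set i]) => // j /=.
by apply: contra_neqP => ij; rewrite dfwithout ?normr0//; apply/eqP => /esym.
Qed.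

Definition bslsum_inj (i : I) (b : A i) : bslsum := BslSum (@bslsum_inj_subproof i b).

End bslsum.

Arguments bslsum {R I} E A.
Arguments bslsum_inj {R I} E A i b.

(* Main.v *)
(** Let [pi : A -> A_i] be the coordinate projection, a contractive algebra
    homomorphism with right inverse [iota_i]. A bounded derivation [D] on [A_i]
    lifts to [pi^* \o D \o pi] on [A], of norm at most that of [D]; if [psi]
    implements the lift, then [psi \o iota_i] implements [D]. Finally
    [iota_i b] has norm [`|b|] times that of [delta_i]. *)

Require Import Defs.
From HB Require Import structures.
From mathcomp Require Import all_boot all_order all_algebra.
From mathcomp Require Import all_classical all_reals.
From mathcomp Require Import ereal topology normedtype.

Set Implicit Arguments.
Unset Strict Implicit.
Unset Printing Implicit Defensive.

Import Order.TTheory GRing.Theory Num.Theory.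
Import numFieldNormedType.Exports.
Local Open Scope classical_set_scope.
Local Open Scope ring_scope.

(** * Bounded maps and their adjoints *)

Lemma opnorm_comp (R : realType) (U V W : normedZmodType R[i])
    (f : V -> W) (g : U -> V) : bounded_map f -> bounded_map g ->
  bounded_map (f \o g) /\ opnorm (f \o g) <= opnorm f * opnorm g.
Proof.
move=> fb gb.
have H x : rnorm ((f \o g) x) <= opnorm f * opnorm g * rnorm x.
  rewrite (le_trans (opnormP fb _))// -mulrA.
  by rewrite ler_wpM2l ?opnorm_ge0// opnormP.
split; first by exists (opnorm f * opnorm g).
by apply: opnorm_le => //; rewrite mulr_ge0 ?opnorm_ge0.
Qed.

Section dual_map.
Variables (R : realType) (V W : normedModType R[i]) (f : {linear V -> W}).
Hypothesis fb : bounded_map f.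

Lemma dual_map_subproof (phi : dual W) : phi \o f \in @dual_pred R V.
Proof.
apply/dual_predP; split=> [k x y|]; first by rewrite /= !linearP.
by case: (opnorm_comp (dual_bounded phi) fb).
Qed.

(** The Banach-space adjoint [f^*]. *)
Definition dual_map (phi : dual W) : dual V := Dual (dual_map_subproof phi).

Lemma dual_map_linear : linear dual_map.
Proof. by move=> k phi psi; apply: val_inj. Qed.

HB.instance Definition _ :=
  GRing.isLinear.Build R[i] (dual W) (dual V) *:%R dual_map dual_map_linear.

Lemma rnorm_dual_map phi : rnorm (dual_map phi) <= rnorm phi * opnorm f.
Proof. by case: (opnorm_comp (dual_bounded phi) fb). Qed.

End dual_map.

Lemma WAM_ge0 (R : realType) (A : banachAlgType R[i]) : (0 <= WAM A)%E.
Proof. by apply: le_ereal_inf_tmp => _ [C [C0 _] <-]; rewrite lee_fin. Qed.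

(** * Weak amenability passes to retracts of Banach algebras *)

Section retract.
Variables (R : realType) (A B : banachAlgType R[i]).
Variables (pi : {linear A -> B}) (iota : {linear B -> A}).
Hypothesis piM : {morph pi : a b / bmul a b}.
Hypothesis iotaM : {morph iota : a b / bmul a b}.
Hypothesis iotaK : cancel iota pi.
Hypothesis pi_le : forall a, rnorm (pi a) <= rnorm a.
Hypothesis iota_bounded : bounded_map iota.

Let pi_bounded : bounded_map pi.
Proof. by exists 1 => a; rewrite mul1r. Qed.

Definition lift_derivation (D : {linear B -> dual B}) :
    {linear A -> dual A} := dual_map pi_bounded \o D \o pi.

(** Both [pi] and its adjoint are contractive, so lifting costs no constant; only [opnorm iota] will
    enter the final estimate. *)
Lemma lift_derivation_opnorm (D : {linear B -> dual B}) :
  bounded_map D ->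
  bounded_map (lift_derivation D) /\ opnorm (lift_derivation D) <= opnorm D.
Proof.
move=> Db.
have H a : rnorm (lift_derivation D a) <= opnorm D * rnorm a.
  rewrite (le_trans (rnorm_dual_map _ _))//.
  have pi1 : opnorm pi <= 1 by apply: opnorm_le => // x; rewrite mul1r.
  rewrite (le_trans (ler_wpM2l (rnorm_ge0 _) pi1))// mulr1.
  by rewrite (le_trans (opnormP Db _))// ler_wpM2l ?opnorm_ge0.
split; first by exists (opnorm D).
by apply: opnorm_le; rewrite ?opnorm_ge0.
Qed.

(** As [pi] is multiplicative, [pi^*] intertwines the module actions: letting [pi a] act on a
    functional and then applying [pi^*] equals applying [pi^*] and then letting [a] act, on either
    side. The Leibniz rule for [D] is thereby transported. *)
Lemma lift_derivation_bounded (D : {linear B -> dual B}) :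
  bounded_derivation D -> bounded_derivation (lift_derivation D).
Proof.
move=> [Db Dd]; split; first by case: (lift_derivation_opnorm Db).
move=> a b; apply: val_inj; apply/funext => x /=.
rewrite piM Dd.
change (D (pi b) (bmul (pi x) (pi a)) + D (pi a) (bmul (pi b) (pi x)) =
  D (pi b) (pi (bmul x a)) + D (pi a) (pi (bmul b x))).
by rewrite !piM.
Qed.

(** Evaluate the hypothesis at [iota b] and [iota x]: [pi] cancels [iota] on the left, and
    multiplicativity of [iota] rewrites the right side. *)
Lemma ad_retract (D : {linear B -> dual B}) (psi : dual A) :
  lift_derivation D =1 ad psi -> D =1 ad (dual_map iota_bounded psi).
Proof.
move=> Dpsi b; apply: val_inj; apply/funext => x.
have : lift_derivation D (iota b) (iota x) = ad psi (iota b) (iota x).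
  by rewrite Dpsi.
change (D (pi (iota b)) (pi (iota x)) =
  psi (bmul (iota x) (iota b)) - psi (bmul (iota b) (iota x)) ->
  D b x = psi (iota (bmul x b)) - psi (iota (bmul b x))).
by rewrite !iotaK !iotaM.
Qed.

Lemma weakly_amenable_retract : weakly_amenable A -> weakly_amenable B.
Proof.
move=> wA D /lift_derivation_bounded /wA[psi Dpsi].
by exists (dual_map iota_bounded psi); exact: ad_retract.
Qed.

(** Each constant [C] admissible for [A] makes [opnorm iota * C] admissible for [B]. The infimum
    defining [WAM A] may not be attained, so it is approached within an arbitrary error. *)
Lemma WAM_retract :
  (WAM A < +oo)%E -> (WAM B <= (opnorm iota)%:E * WAM A)%E.
Proof.
move=> WAoo.
have WAfin : WAM A \is a fin_num by rewrite ge0_fin_numE ?WAM_ge0.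
have le C : 0 <= C -> (forall D : {linear A -> dual A}, bounded_derivation D ->
      exists2 phi, D =1 ad phi & rnorm phi <= C * opnorm D) ->
    (WAM B <= (opnorm iota * C)%:E)%E.
  move=> C0 CP; apply: ereal_inf_lbound; exists (opnorm iota * C) => //.
  split=> [|D Dbd]; first by rewrite mulr_ge0 ?opnorm_ge0.
  have [psi Dpsi psiC] := CP _ (lift_derivation_bounded Dbd).
  exists (dual_map iota_bounded psi); first exact: ad_retract.
  rewrite (le_trans (rnorm_dual_map _ _))// mulrC -mulrA.
  rewrite ler_wpM2l ?opnorm_ge0// (le_trans psiC)// ler_wpM2l//.
  by case: (lift_derivation_opnorm Dbd.1).
apply/lee_addgt0Pr => e e0.
(* Adding 1 keeps the denominator positive even if [opnorm iota] is 0, and still gives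
   [opnorm iota * d <= e] for this tolerance [d]. *)
have d0 : 0 < e / (opnorm iota + 1).
  by rewrite divr_gt0// ltr_wpDl ?opnorm_ge0.
have [_ [C [C0 CP] <-]] := lb_ereal_inf_adherent d0 WAfin.
rewrite -/(WAM A) => /ltW CW.
apply: (le_trans (le C C0 CP)).
move: CW; rewrite -(fineK WAfin) -EFinD -EFinM -EFinD !lee_fin => CW.
rewrite (le_trans (ler_wpM2l (opnorm_ge0 _) CW))// mulrDr lerD2l.
rewrite mulrCA ler_piMr ?(ltW e0)// ler_pdivrMr ?ltr_wpDl ?opnorm_ge0//.
by rewrite mul1r lerDl.
Qed.

End retract.

(** * Coordinate projection and embedding of the [E]-sum *)

Section coordinate.
Variables (R : realType) (I : choiceType) (E : bseqLattice R I).
Variables (A : I -> banachAlgType R[i]) (i : I).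

Definition bslsum_proj (a : bslsum E A) : A i := a i.

Lemma bslsum_proj_linear : linear bslsum_proj.
Proof. by []. Qed.

HB.instance Definition _ := GRing.isLinear.Build R[i] (bslsum E A) (A i) *:%R
  bslsum_proj bslsum_proj_linear.

Lemma bslsum_injE (b : A i) : bslsum_inj E A i b i = b.
Proof. exact: dfwithin. Qed.

Lemma bslsum_inj_neq (b : A i) j : i != j -> bslsum_inj E A i b j = 0.
Proof. exact: dfwithout. Qed.

Lemma bslsum_inj_linear : linear (bslsum_inj E A i).
Proof.
move=> k a b; apply: bslsum_eq => j.
change (bslsum_inj E A i (k *: a + b) j =
  k *: bslsum_inj E A i a j + bslsum_inj E A i b j).
have [<-|ij] := eqVneq i j; first by rewrite !bslsum_injE.
by rewrite !bslsum_inj_neq// scaler0 addr0.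
Qed.

HB.instance Definition _ := GRing.isLinear.Build R[i] (A i) (bslsum E A) *:%R
  (bslsum_inj E A i) bslsum_inj_linear.

Lemma bmul0 (B : banachAlgType R[i]) (a : B) : bmul a 0 = 0.
Proof.
(* Linearity with scalar -1 at the zero vectors reads [bmul a 0 = - bmul a 0 + bmul a 0]. *)
by have := bmul_linearr a (-1) 0 0; rewrite !scaleN1r oppr0 addr0 addNr.
Qed.

Lemma bslsum_injM : {morph bslsum_inj E A i : a b / bmul a b}.
Proof.
move=> a b; apply: bslsum_eq => j.
change (bslsum_inj E A i (bmul a b) j =
  bmul (bslsum_inj E A i a j) (bslsum_inj E A i b j)).
have [<-|ij] := eqVneq i j; first by rewrite !bslsum_injE.
by rewrite !bslsum_inj_neq// bmul0.
Qed.

Lemma bslsum_projK : cancel (bslsum_inj E A i) bslsum_proj.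
Proof. exact: bslsum_injE. Qed.

Lemma rnorm_bslsum_proj a : rnorm (bslsum_proj a) <= rnorm a.
Proof. by rewrite -lecR -!normE bslsum_coord_normr. Qed.

(** Guarantees that [bsl_norm E (dirac_fun R i)] is the true norm and not the default value 0. *)
Lemma bsl_mem_dirac : bsl_mem E (dirac_fun R i).
Proof.
apply: bsl_c00; apply: (@sub_finite_set _ _ [set i]) => // j /=.
by rewrite /dirac_fun; case: (eqVneq j i) => // _; rewrite mulr0n eqxx.
Qed.

Lemma rnorm_bslsum_inj (b : A i) :
  rnorm (bslsum_inj E A i b) = bsl_norm E (dirac_fun R i) * rnorm b.
Proof.
rewrite -[LHS]rnorm_norm bslsum_normrE rnorm_norm.
suff -> : bslsum_nrm (bslsum_inj E A i b) =
    `|b| *: bsl_elt E (dirac_fun R i) by rewrite rnormZ rnorm_norm mulrC.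
apply: bsl_fun_inj; apply/funext => j.
rewrite bslsum_nrmE bsl_funZ (bsl_eltK bsl_mem_dirac) /dirac_fun eq_sym.
have [<-|ij] := eqVneq i j; first by rewrite bslsum_injE mulr1.
by rewrite bslsum_inj_neq// normr0 mulr0.
Qed.

Lemma bslsum_inj_bounded : bounded_map (bslsum_inj E A i).
Proof.
by exists (bsl_norm E (dirac_fun R i)) => b; rewrite rnorm_bslsum_inj.
Qed.

Lemma opnorm_bslsum_inj_le :
  opnorm (bslsum_inj E A i) <= bsl_norm E (dirac_fun R i).
Proof.
by apply: opnorm_le => [|b]; rewrite ?rnorm_ge0// rnorm_bslsum_inj.
Qed.

(** A nonzero [b] attains the bound. If [A i] is trivial, the operator norm is 0, whereas [bsl_sup]
    gives the Dirac mass norm at least 1. *)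
Lemma opnorm_bslsum_inj (b : A i) : b != 0 ->
  opnorm (bslsum_inj E A i) = bsl_norm E (dirac_fun R i).
Proof.
move=> b0; apply/eqP; rewrite eq_le opnorm_bslsum_inj_le/=.
have rb0 : 0 < rnorm b.
  rewrite lt_neqAle rnorm_ge0 andbT eq_sym.
  by apply: contra_neq b0 => /rnorm_eq0.
by rewrite -(ler_pM2r rb0) -rnorm_bslsum_inj opnormP//; exact: bslsum_inj_bounded.
Qed.

End coordinate.

Theorem proposition7p5 (R : realType) (I : choiceType)
    (I_nonempty : [set: I] !=set0) (E : bseqLattice R I)
    (A : I -> banachAlgType R[i]) :
  (weakly_amenable (bslsum E A) -> forall i : I, weakly_amenable (A i)) /\
  ((WAM (bslsum E A) < +oo)%E -> forall i : I,
    [/\ (WAM (A i) <= (opnorm (bslsum_inj E A i))%:E * WAM (bslsum E A))%E,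
        (WAM (A i) <= (bsl_norm E (dirac_fun R i))%:E * WAM (bslsum E A))%E &
        (exists b : A i, b != 0) ->
        ((opnorm (bslsum_inj E A i))%:E * WAM (bslsum E A) =
         (bsl_norm E (dirac_fun R i))%:E * WAM (bslsum E A))%E]).
Proof.
have projM i : {morph @bslsum_proj R I E A i : a b / bmul a b} by [].
split=> [wA i|WAoo i].
  exact: (weakly_amenable_retract (projM i) (@bslsum_injM _ _ E A i)
    (@bslsum_projK _ _ E A i) (@rnorm_bslsum_proj _ _ E A i)
    (bslsum_inj_bounded E A i)).
have le := WAM_retract (projM i) (@bslsum_injM _ _ E A i)
    (@bslsum_projK _ _ E A i) (@rnorm_bslsum_proj _ _ E A i)
    (bslsum_inj_bounded E A i) WAoo.
split=> //; last by move=> [b b0]; rewrite (opnorm_bslsum_inj E b0).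
(* Only the inequality between the two norms is used here, so a trivial [A i] is covered. *)
apply: (le_trans le).
by rewrite lee_wpmul2r ?WAM_ge0// lee_fin opnorm_bslsum_inj_le.
Qed.
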